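(* Assume binary sensor messages ($l=2$). For each $m=0,\dots,M-1$, a maximin quantizer $\bar\phi^{\max}_m$ for state $m$ exists, and it can be chosen as a randomization of at most $M-1$ deterministic quantizers. Moreover, if the densities $f_0,\dots,f_{M-1}$ are linearly independent, then $\bar\phi^{\max}_m$ can be chosen as a randomization of at most $M-1$ deterministic unambiguous likelihood quantizers (ULQs).
   Context: Setting: a raw observation $X$ has, under state $m\in\{0,\dots,M-1\}$ (probability $\mathbf P_m$), density $f_m$ with respect to a common $\sigma$-finite measure. Standing assumption: for all $m\neq m'$, $0<\mathbf E_m[\log(f_m(X)/f_{m'}(X))]<\infty$. A deterministic quantizer is a measurable map $\phi$ from the observation space to $\{0,1\}$; $\Phi$ is the set of these. A randomized quantizer $\bar\phi=\sum_j p^j\phi^j$ is a probability distribution $(p^j)$ on a countable set $\{\phi^j\}\subset\Phi$; deterministic quantizers are identified with randomized ones of mass one; $\bar\Phi$ is the set of all quantizers. For $\phi\in\Phi$, $f_m(u;\phi)=\mathbf P_m(\phi(X)=u)$ and $I(m,m';\phi)=\sum_{u}f_m(u;\phi)\log\frac{f_m(u;\phi)}{f_{m'}(u;\phi)}$; for $\bar\phi=\sum_jp^j\phi^j$, $I(m,m';\bar\phi)=\sum_jp^jI(m,m';\phi^j)$; $I(m;\bar\phi)=\min_{m'\neq m}I(m,m';\bar\phi)$; $I(m)=\sup_{\bar\phi\in\bar\Phi}I(m;\bar\phi)$; a maximin quantizer for state $m$ is a $\bar\phi\in\bar\Phi$ with $I(m;\bar\phi)=I(m)$. A deterministic quantizer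 $\phi$ is an unambiguous likelihood quantizer (ULQ) if there are reals $a_0,\dots,a_{M-1}$ with $\phi(X)=\mathbf 1\{\sum_m a_mf_m(X)>0\}$ and $\mathbf P_{m'}\{\sum_m a_mf_m(X)=0\}=0$ for every $m'$. The densities $f_0,\dots,f_{M-1}$ are linearly independent if $\mathbf P_{m'}\{\sum_ma_mf_m(X)=0\}=0$ for every $m'$ and every $(a_0,\dots,a_{M-1})$ not all zero. *)

(* Defs.v *)
From HB Require Import structures.
From mathcomp Require Import all_boot all_order all_algebra.
From mathcomp Require Import all_classical all_reals all_analysis.
Set Implicit Arguments. Unset Strict Implicit. Unset Printing Implicit Defensive.
Import Order.TTheory GRing.Theory Num.Theory numFieldNormedType.Exports.
Local Open Scope classical_set_scope.
Local Open Scope ring_scope.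

Section Quantizers.
Context {R : realType} {d : measure_display} {T : measurableType d}.
Variable mu : {measure set T -> \bar R}.
Variable M : nat.
Variable f : 'I_M -> T -> R.

Definition Pm (m : 'I_M) (A : set T) : \bar R := (\int[mu]_(x in A) (f m x)%:E)%E.

(* integrand of E_m[log(f_m(X)/f_m'(X))] against mu, with the conventions
   0 log(0/q) = 0 and p log(p/0) = +oo for p > 0 *)
Definition kl_integrand (m m' : 'I_M) (x : T) : \bar R :=
  if 0 < f m x then
    (if 0 < f m' x then ((f m x) * ln (f m x / f m' x))%:E else +oo%E)
  else 0%E.

Definition KL (m m' : 'I_M) : \bar R := (\int[mu]_x kl_integrand m m' x)%E.

Definition is_quantizer (phi : T -> bool) : Prop :=
  measurable [set x | phi x].

Definition fq (m : 'I_M) (phi : T -> bool) (u : bool) : R :=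
  fine (Pm m [set x | phi x = u]).

Definition klterm (p q : R) : \bar R :=
  if p == 0 then 0%E else if q == 0 then +oo%E else (p * ln (p / q))%:E.

Definition Idet (m m' : 'I_M) (phi : T -> bool) : \bar R :=
  (klterm (fq m phi false) (fq m' phi false) +
   klterm (fq m phi true) (fq m' phi true))%E.

Record rquant := RQuant { rq_w : nat -> R ; rq_phi : nat -> T -> bool }.

Definition is_rquant (q : rquant) : Prop :=
  (forall j, 0 <= rq_w q j) /\
  (forall j, is_quantizer (rq_phi q j)) /\
  (fun n => \sum_(0 <= j < n) rq_w q j) @ \oo --> (1 : R).

Definition Ipair (m m' : 'I_M) (q : rquant) : \bar R :=
  (\sum_(0 <= j <oo) ((rq_w q j)%:E * Idet m m' (rq_phi q j)))%E.

Definition Irq (m : 'I_M) (q : rquant) : \bar R :=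
  ereal_inf [set Ipair m m' q | m' in [set m' : 'I_M | m' != m]].

Definition Imax (m : 'I_M) : \bar R :=
  ereal_sup [set Irq m q | q in [set q | is_rquant q]].

Definition is_maximin (m : 'I_M) (q : rquant) : Prop :=
  is_rquant q /\ Irq m q = Imax m.

(* randomization of at most n deterministic quantizers *)
Definition supported_on_first (n : nat) (q : rquant) : Prop :=
  forall j, (0 < rq_w q j) -> (j < n)%N.

Definition lincomb (a : 'I_M -> R) (x : T) : R := \sum_(m < M) a m * f m x.

Definition is_ULQ (phi : T -> bool) : Prop :=
  exists a : 'I_M -> R,
    (forall x, phi x = (0 < lincomb a x)) /\
    (forall m', Pm m' [set x | lincomb a x = 0] = 0%E).

Definition lin_indep_densities : Prop :=
  forall a : 'I_M -> R, (exists m, a m != 0) ->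
    forall m', Pm m' [set x | lincomb a x = 0] = 0%E.

End Quantizers.

(* Main.v *)
Require Import Defs.
From HB Require Import structures.
From mathcomp Require Import all_boot all_order all_algebra.
From mathcomp Require Import all_classical all_reals all_analysis.
From mathcomp Require Import measurable_realfun ring lra.
Import Order.TTheory GRing.Theory Num.Theory numFieldNormedType.Exports.
Local Open Scope classical_set_scope.
Local Open Scope ring_scope.

(** Write D(phi) for the vector of the n = M - 1 divergences I(m, m'; phi).

    Half-spaces suffice: for nonnegative weights u the functional u . D(phi) is
    convex in the vector of probabilities P_k(phi = 1), so it is minorized by its
    linearization at phi, which is maximized by a quantizer of the form
    1{sum_k a_k f_k > 0}.

    Compactness: any sequence of linear half-spaces of R^M has a subsequence whose
    indicators converge pointwise everywhere, and D passes to the limit by dominated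
    convergence because the Kullback-Leibler divergences are finite. Under linear
    independence the limit is almost surely a half-space indicator, hence a ULQ.

    Maximin: let c = I(m). Minimize the squared shortfall of y below c over mixtures y
    of n half-space quantizers. If the minimum is 0, the limiting mixture is a maximin
    quantizer. Otherwise the positive parts u of c - y at the minimizer satisfy
    u . D(phi) <= b < c * sum u for every phi, so no randomization comes close to c,
    a contradiction. Mixtures of n points suffice because a mixture of n + 1 points of
    R^n is dominated coordinatewise by a mixture of n of them. *)

(** * Subsequences and half-spaces *)

(** Subsequences are encoded by [k <= s k] instead of strict monotonicity: this is stable under
    composition and suffices to transport limits at infinity. *)
Lemma cvg_infty_ge_id (s : nat -> nat) : (forall k, k <= s k)%N -> s k @[k --> \oo] --> \oo.
Proof.
move=> s_ge A [N _ NA]; exists N => // k /= Nk; apply: NA => /=.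
exact: leq_trans Nk (s_ge k).
Qed.

(** Bolzano-Weierstrass: [s k] is an index beyond [k] at which [u] is within [1 / (k + 1)] of a
    cluster point in the segment from [- b] to [b]. *)
Lemma bounded_cvg_subsequence {R : realType} (u : nat -> R) (b : R) :
  (forall k, `|u k| <= b) ->
  exists s : nat -> nat, (forall k, k <= s k)%N /\ exists l : R, u (s k) @[k --> \oo] --> l.
Proof.
move=> ub.
have [|l [_ ul]] := @segment_compact R (- b) b (u k @[k --> \oo]) _.
  by exists 0%N => // k _ /=; rewrite in_itv /= -ler_norml.
have E k : exists j, (k <= j)%N /\ `|l - u j| < k.+1%:R^-1.
  have [] := ul (u @` [set j | (k <= j)%N]) (ball l k.+1%:R^-1).
  - by exists k => // j kj; exists j.
  - by apply: nbhsx_ballx; rewrite invr_gt0.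
  - by move=> _ [[j kj <-] lj]; exists j.
have [s sP] := choice E.
exists s; split; first by move=> k; case: (sP k).
exists l; apply/cvgrPdist_lt => e e0; near=> k.
apply: lt_trans (proj2 (sP k)) _.
near: k; exact: near_infty_natSinv_lt (PosNum e0).
Unshelve. all: by end_near. Qed.

(** Finitely many successive extractions: each one keeps what the others achieved because [C i]
    passes to further subsequences. *)
Lemma common_subsequence {I : eqType} (r : seq I) (C : I -> (nat -> nat) -> Prop) :
  (forall i s t, (forall k, k <= t k)%N -> C i s -> C i (s \o t)) ->
  (forall i s, (forall k, k <= s k)%N ->
     exists t, (forall k, k <= t k)%N /\ C i (s \o t)) ->
  exists s, (forall k, k <= s k)%N /\ forall i, i \in r -> C i s.
Proof.
move=> Csub Cex; elim: r => [|i r [s [s_ge sr]]]; first by exists id.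
have [t [t_ge ti]] := Cex i s s_ge.
exists (s \o t); split; first by move=> k; exact: leq_trans (t_ge k) (s_ge _).
by move=> j; rewrite in_cons => /predU1P[->//|jr]; apply: Csub => //; exact: sr.
Qed.

Lemma bounded_cvg_subsequence_fin {R : realType} {I : finType} (u : nat -> I -> R) (b : R) :
  (forall k i, `|u k i| <= b) ->
  exists s, (forall k, k <= s k)%N /\
    exists l : I -> R, forall i, u (s k) i @[k --> \oo] --> l i.
Proof.
move=> ub.
have [|i s s_ge|s [s_ge sP]] := @common_subsequence I (enum I)
    (fun i s => exists l : R, u (s k) i @[k --> \oo] --> l).
- move=> i s t t_ge [l sl]; exists l.
  by apply: cvg_comp sl; exact: cvg_infty_ge_id.
- by apply: (bounded_cvg_subsequence (fun k => u (s k) i)) => k; exact: ub.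
- exists s; split=> //.
  have [l lP] := choice (fun i => sP i (mem_enum _ _)).
  by exists l.
Qed.

Definition dotp {R : realType} {n : nat} (a y : 'I_n -> R) : R := \sum_i a i * y i.

Lemma dotpZl {R : realType} {n : nat} (c : R) (a y : 'I_n -> R) :
  dotp (fun i => c * a i) y = c * dotp a y.
Proof. by rewrite /dotp mulr_sumr; apply: eq_bigr => i _; rewrite mulrA. Qed.

Lemma cvg_dotp {R : realType} {n : nat} (a : nat -> 'I_n -> R) (g y : 'I_n -> R) :
  (forall i, a k i @[k --> \oo] --> g i) -> dotp (a k) y @[k --> \oo] --> dotp g y.
Proof.
move=> ag; rewrite /dotp; apply: cvg_big => [|i _]; first exact: add_continuous.
by apply: cvgM => //; exact: cvg_cst.
Qed.

(* By induction on the dimension: normalize the normals a_k so that they converge to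
   some g and share a nonzero coordinate i with it. Where g . y <> 0 the sign settles;
   on the hyperplane g . y = 0 the normals act as a_k - g, which has no i-th coordinate. *)
Lemma halfspace_subsequence {R : realType} {n : nat} (a : nat -> 'I_n -> R) :
  exists s, (forall k, k <= s k)%N /\ exists g : 'I_n -> R,
    [/\ forall y, dotp g y != 0 ->
          \forall k \near \oo, (0 < dotp (a (s k)) y) = (0 < dotp g y),
        forall y, exists b, \forall k \near \oo, (0 < dotp (a (s k)) y) = b
      & (forall k, exists i, a k i != 0) -> exists i, g i != 0].
Proof.
elim: n a => [|n IH] a.
  exists id; split=> //; exists (a 0%N); split.
  - by move=> y; rewrite /dotp big_ord0 eqxx.
  - by move=> y; exists false; near=> k; rewrite /dotp big_ord0 ltxx.
  - by move/(_ 0%N).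
pose N k := \sum_i `|a k i|.
have N_ge0 k : 0 <= N k by exact: sumr_ge0.
(* If [a k] is zero then so is [N k], and division by zero makes [b k] zero, which still obeys the
   bound. *)
pose b k i := a k i / N k.
have b_le1 k i : `|b k i| <= 1.
  have aN : `|a k i| <= N k by rewrite /N (bigD1 i) //= lerDl sumr_ge0.
  rewrite /b normrM normfV (ger0_norm (N_ge0 k)).
  have [N0|N0] := eqVneq (N k) 0; first by rewrite N0 invr0 mulr0.
  by rewrite ler_pdivrMr ?mul1r // lt_neqAle eq_sym N0 N_ge0.
have [s [s_ge [g bg]]] := bounded_cvg_subsequence_fin b 1 b_le1.
have [[i gi0]|g0] := pselect (exists i, g i != 0); last first.
  have {}g0 i : g i = 0 by apply/eqP; apply: contra_notT g0 => gi; exists i.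
  have : (\sum_i `|b (s k) i|) @[k --> \oo] --> \sum_(i < n.+1) `|g i|.
    apply: cvg_big => [|i _]; first exact: add_continuous.
    exact: cvg_norm.
  rewrite big1 => [b0|i _]; last by rewrite g0 normr0.
  (* A nonzero normal has a normalization of l1-norm 1, so convergence of these norms to 0 forces
     [a (s k) = 0] eventually; the half-spaces are then empty. *)
  have a0 : \forall k \near \oo, forall i, a (s k) i = 0.
    apply: filterS (cvgr_lt _ b0 1 ltr01) => k bk1 i.
    have N0 : N (s k) = 0.
      apply/eqP; apply: contraT => N0.
      suff E : \sum_i `|b (s k) i| = 1 by rewrite E ltxx in bk1.
      rewrite /b; under eq_bigr => j _ do rewrite normrM normfV (ger0_norm (N_ge0 _)).
      by rewrite -mulr_suml divff.
    apply/eqP; rewrite -normr_eq0 eq_le normr_ge0 andbT.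
    by rewrite -N0 /N (bigD1 i) //= lerDl sumr_ge0.
  have d0 y : \forall k \near \oo, dotp (a (s k)) y = 0.
    apply: filterS a0 => k ak0; rewrite /dotp big1 // => i _.
    by rewrite ak0 mul0r.
  exists s; split=> //; exists g; split.
  - by move=> y; rewrite /dotp big1 ?eqxx // => i _; rewrite g0 mul0r.
  - by move=> y; exists false; apply: filterS (d0 y) => k ->; rewrite ltxx.
  - move=> an0; exfalso; have [K _ /(_ K (leqnn K)) aK] := a0.
    by have [i] := an0 (s K); rewrite aK eqxx.
(* An eventually positive rescaling, which changes no sign, chosen so that [c k] converges to [g]
   and its i-th coordinate eventually equals [g i]. *)
pose r k := `|g i| / `|a (s k) i|.
pose c k j := r k * a (s k) j.
have rc k : a (s k) i != 0 -> forall j, c k j = b (s k) j * (`|g i| / `|b (s k) i|).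
  move=> ai0 j.
  have N0 : N (s k) != 0.
    apply: contra_neq ai0 => N0; apply/eqP; rewrite -normr_eq0 eq_le normr_ge0 andbT.
    by rewrite -N0 /N (bigD1 i) //= lerDl sumr_ge0.
  rewrite /c /r /b normrM normfV (ger0_norm (N_ge0 _)).
  have : `|a (s k) i| != 0 by rewrite normr_eq0.
  by move=> ?; field; apply/andP.
have sgn : \forall k \near \oo, 0 < b (s k) i * g i.
  have /cvgr_gt : b (s k) i * g i @[k --> \oo] --> g i * g i.
    by apply: cvgM; [exact: bg | exact: cvg_cst].
  by apply; rewrite -expr2 exprn_even_gt0.
have ai0 : \forall k \near \oo, a (s k) i != 0.
  apply: filterS sgn => k; apply: contraTneq => ai.
  by rewrite /b ai !mul0r ltxx.
have r0 : \forall k \near \oo, 0 < r k.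
  by apply: filterS ai0 => k aki; rewrite /r divr_gt0 ?normr_gt0.
have ci : \forall k \near \oo, c k i = g i.
  near=> k; rewrite rc; last by near: k.
  have : 0 < b (s k) i * g i by near: k.
  case: (ltrgt0P (b (s k) i)) => [b0|b0|->]; last by rewrite mul0r ltxx.
  - rewrite pmulr_rgt0 // => gi; rewrite (gtr0_norm gi).
    by rewrite mulrCA divff ?mulr1 // gt_eqF.
  - rewrite nmulr_rgt0 // => gi; rewrite (ltr0_norm gi).
    by rewrite invrN mulrNN mulrCA divff ?mulr1 // lt_eqF.
have cg j : c k j @[k --> \oo] --> g j.
  have : b (s k) j * (`|g i| / `|b (s k) i|) @[k --> \oo] --> g j * (`|g i| / `|g i|).
    apply: cvgM; first exact: bg.
    apply: cvgM; first exact: cvg_cst.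
    by apply: cvgV; [rewrite normr_eq0|apply: cvg_norm; exact: bg].
  rewrite divff ?normr_eq0 // mulr1; apply: cvg_trans.
  apply: near_eq_cvg; apply: filterS ai0 => k aki.
  by rewrite rc.
have [t [t_ge [_ [_ et _]]]] := IH (fun k j => c k (lift i j) - g (lift i j)).
have st_ge k : (k <= s (t k))%N by exact: leq_trans (t_ge k) (s_ge _).
have t_oo := cvg_infty_ge_id _ t_ge.
have dc y : \forall k \near \oo, (0 < dotp (a (s (t k))) y) = (0 < dotp (c (t k)) y).
  near=> k; have rk : 0 < r (t k) by near: k; exact: t_oo _ r0.
  by rewrite /c dotpZl pmulr_rgt0.
have dg y : dotp g y != 0 ->
    \forall k \near \oo, (0 < dotp (a (s (t k))) y) = (0 < dotp g y).
  move=> gy0.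
  have dcg : dotp (c (t k)) y @[k --> \oo] --> dotp g y.
    by apply: cvg_dotp => j; apply: cvg_comp (cg j).
  case: (ltrgt0P (dotp g y)) gy0 => // gy _.
  - by near=> k; rewrite (near (dc y) k) //; near: k; exact: (cvgr_gt _ dcg).
  - near=> k; rewrite (near (dc y) k) //; apply/negbTE; rewrite -leNgt ltW //.
    by near: k; exact: (cvgr_lt _ dcg).
exists (s \o t); split=> //; exists g; split=> //; last by exists i.
move=> y; have [gy|/dg gy] := eqVneq (dotp g y) 0; last by exists (0 < dotp g y).
have [v ev] := et (fun j => y (lift i j)).
exists v; near=> k.
rewrite /= (near (dc y) k) // -(near ev k) //; congr (0 < _).
have ctk : c (t k) i = g i by near: k; exact: t_oo _ ci.
rewrite -[LHS]subr0 -[in LHS]gy /dotp -sumrB (bigD1_ord i) //= ctk subrr add0r.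
by apply: eq_bigr => j _; rewrite mulrBl.
Unshelve. all: by end_near. Qed.

(** * Mixtures and the maximin alternative *)

(* A kernel vector (kappa, delta) of n + 2 unknowns under n + 1 equations, with the sign
   chosen so that moving a mixture along - delta raises all coordinates by kappa >= 0. *)
Lemma ex_ascent_dependence {R : realFieldType} {n : nat} (s : 'I_n.+2 -> 'I_n.+1 -> R) :
  exists delta : 'I_n.+2 -> R,
    [/\ exists j, 0 < delta j, \sum_j delta j = 0
      & forall i, \sum_j delta j * s j i <= 0].
Proof.
(* Row 0 carries kappa, the other rows the [delta j]. Column 0 says that the [delta j] sum to 0;
   each other column says that kappa plus the [delta]-combination of one coordinate is 0. There is
   one more row than columns, hence a nonzero kernel vector. *)
pose B : 'M[R]_(n.+3, n.+2) := \matrix_(r, c)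
  match unlift ord0 r, unlift ord0 c with
  | Some j, Some i => s j i | Some _, None => 1 | None, Some _ => 1 | None, None => 0
  end.
have [v v0 vB] : exists2 v : 'rV[R]_n.+3, v != 0 & v *m B = 0.
  have kB : kermx B != 0.
    rewrite -mxrank_eq0 mxrank_ker subn_eq0 -ltnNge.
    exact: leq_ltn_trans (rank_leq_col _) _.
  exists (nz_row (kermx B)); first by rewrite nz_row_eq0.
  by apply/sub_kermxP; exact: nz_row_sub.
have eqs (w : 'rV[R]_n.+3) : w *m B = 0 ->
    \sum_j w 0 (lift ord0 j) = 0 /\
    forall i, \sum_j w 0 (lift ord0 j) * s j i = - w 0 ord0.
  move=> wB; split=> [|i].
  - have := congr1 (fun u : 'rV_n.+2 => u 0 ord0) wB.
    rewrite !mxE big_ord_recl !mxE !unlift_none mulr0 add0r => E.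
    apply: etrans E.
    by apply: eq_bigr => j _; rewrite !mxE liftK unlift_none mulr1.
  - have := congr1 (fun u : 'rV_n.+2 => u 0 (lift ord0 i)) wB.
    rewrite !mxE big_ord_recl !mxE unlift_none liftK mulr1 => /eqP.
    rewrite addrC addr_eq0 => /eqP E.
    by apply: etrans E; apply: eq_bigr => j _; rewrite !mxE !liftK.
wlog v0_ge0 : v v0 vB / 0 <= v 0 ord0.
  move=> H; have [|v0_lt0] := leP 0 (v 0 ord0); first exact: H.
  apply: (H (- v)); first by rewrite oppr_eq0.
  - by rewrite mulNmx vB oppr0.
  - by rewrite mxE oppr_ge0 ltW.
have [vsum vs] := eqs v vB.
exists (fun j => v 0 (lift ord0 j)); split=> //; last first.
  by move=> i; rewrite vs oppr_le0.
(* With no positive entry, the zero sum makes [delta] vanish; then kappa vanishes too, against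
   [v != 0]. *)
apply/not_existsP => vneg.
have vj j : v 0 (lift ord0 j) = 0.
  have /eqP := vsum; rewrite -oppr_eq0 -sumrN psumr_eq0 => [/allP/(_ j)|k _].
    by rewrite mem_index_enum oppr_eq0 => /(_ isT)/eqP.
  by rewrite oppr_ge0 leNgt; apply/negP/vneg.
case/eqP: v0; apply/rowP => r; rewrite mxE.
case: (unliftP ord0 r) => [j ->//|->].
have := vs ord0; rewrite big1 => [/eqP|j _]; last by rewrite vj mul0r.
by rewrite eq_sym oppr_eq0 => /eqP.
Qed.

Definition is_weight {R : numDomainType} {n : nat} (p : 'I_n -> R) : Prop :=
  (forall j, 0 <= p j) /\ \sum_j p j = 1.

(** A Caratheodory-type reduction: moving the weights along [- delta] lowers no coordinate, and the
    least ratio [p j / delta j] over positive [delta j] is the step at which a first weight, that of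
    [j0], reaches 0. *)
Lemma mixture_reduction {R : realFieldType} {n : nat} (s : 'I_n.+2 -> 'I_n.+1 -> R)
    (p : 'I_n.+2 -> R) : is_weight p ->
  exists (j0 : 'I_n.+2) (q : 'I_n.+1 -> R), is_weight q /\
    forall i, \sum_j p j * s j i <= \sum_k q k * s (lift j0 k) i.
Proof.
move=> [p_ge0 p1].
have [delta [[j1 dj1] dsum ds]] := ex_ascent_dependence s.
have [j0 dj0 j0min] := @arg_minP _ _ _ j1 (fun j => 0 < delta j) (fun j => p j / delta j) dj1.
pose t := p j0 / delta j0.
have t_ge0 : 0 <= t by rewrite divr_ge0 // ltW.
pose q j := p j - t * delta j.
have q_ge0 j : 0 <= q j.
  rewrite subr_ge0; have [dj|dj] := ltP 0 (delta j).
    by rewrite -ler_pdivlMr //; exact: j0min.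
  by apply: le_trans (p_ge0 j); rewrite mulr_ge0_le0.
have q0 : q j0 = 0 by rewrite /q /t divfK ?subrr // gt_eqF.
exists j0, (fun k => q (lift j0 k)); split.
  split=> [k //|].
  have : \sum_j q j = 1 by rewrite /q sumrB -mulr_sumr dsum mulr0 subr0.
  by rewrite (bigD1_ord j0) //= q0 add0r.
move=> i.
have : \sum_j q j * s j i = \sum_j p j * s j i - t * \sum_j delta j * s j i.
  by rewrite mulr_sumr -sumrB; apply: eq_bigr => j _; rewrite /q; ring.
rewrite (bigD1_ord j0) //= q0 mul0r add0r => ->.
by rewrite lerDl oppr_ge0 mulr_ge0_le0.
Qed.

(** The squared Euclidean distance from [y] to the orthant of points whose coordinates are all at
    least [c]. *)
Definition shortfall {R : realType} {n : nat} (c : R) (y : 'I_n -> R) : R :=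
  \sum_i Num.max (c - y i) 0 ^+ 2.

Lemma shortfall_anti {R : realType} {n : nat} (c : R) (y z : 'I_n -> R) :
  (forall i, y i <= z i) -> shortfall c z <= shortfall c y.
Proof.
move=> yz; apply: ler_sum => i _.
have m_ge0 (x : R) : Num.max x 0 \is Num.nneg by rewrite nnegrE le_max lexx orbT.
rewrite (ler_sqr (m_ge0 _) (m_ge0 _)) ge_max !le_max lexx orbT andbT.
by rewrite lerD2l lerN2 yz.
Qed.

Lemma cvg_shortfall {R : realType} {n : nat} (c : R) (y : nat -> 'I_n -> R) (l : 'I_n -> R) :
  (forall i, y k i @[k --> \oo] --> l i) ->
  shortfall c (y k) @[k --> \oo] --> shortfall c l.
Proof.
move=> yl; rewrite /shortfall; apply: cvg_big => [|i _]; first exact: add_continuous.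
have mi : Num.max (c - y k i) 0 @[k --> \oo] --> Num.max (c - l i) 0.
  under eq_fun do rewrite maxr_absE !addr0 subr0; rewrite maxr_absE addr0 subr0.
  have cyl : c - y k i @[k --> \oo] --> c - l i.
    by apply: cvgB; [exact: cvg_cst | exact: yl].
  apply: cvgM; last exact: cvg_cst.
  by apply: cvgD => //; exact: cvg_norm.
exact: cvgM.
Qed.

(** The gradient of the shortfall is [-2 max (c - y) 0]. An explicit quadratic upper bound along the
    direction [d] replaces differentiation. *)
Lemma shortfall_first_order {R : realType} {n : nat} (c : R) (y d : 'I_n -> R) :
  (forall t, 0 < t <= 1 -> shortfall c y <= shortfall c (fun i => y i + t * d i)) ->
  \sum_i Num.max (c - y i) 0 * d i <= 0.
Proof.
move=> ymin; set G := \sum_i _; set D := \sum_i d i ^+ 2.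
have D_ge0 : 0 <= D by apply: sumr_ge0 => i _; exact: sqr_ge0.
have GD t : 0 < t <= 1 -> 2 * G <= t * D.
  move=> t01; have /andP[t0 _] := t01.
  have := ymin t t01.
  have : shortfall c (fun i => y i + t * d i) <= shortfall c y - t * (2 * G) + t ^+ 2 * D.
    rewrite /shortfall /G /D !mulr_sumr -sumrB -big_split /=; apply: ler_sum => i _.
    set x := c - y i; have -> : c - (y i + t * d i) = x - t * d i by rewrite /x; ring.
    rewrite /Order.max; case: (ltP x 0) => x0; case: (ltP (x - t * d i) 0) => z0.
    - rewrite expr0n /= !mul0r !mulr0 subr0 add0r mulr_ge0 ?sqr_ge0 //.
    - have : x * (x - t * d i) <= 0 by rewrite mulr_le0_ge0 // ltW.
      have : x * (t * d i) >= 0 by rewrite mulr_le0 ?(ltW x0) //; lra.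
      by nra.
    - by have := sqr_ge0 (x - t * d i); nra.
    - by nra.
  move=> h1 h2; have := le_trans h2 h1; nra.
rewrite leNgt; apply/negP => G0.
(* If [G > 0], the bound [2 * G <= t * D] fails at [t = 1] when [D <= G], and otherwise at
   [t = G / D], where it would read [2 * G <= G]. *)
have [DG|GD'] := leP D G.
  by have := GD 1; rewrite ltr01 lexx => /(_ isT); nra.
have D0 : 0 < D by exact: lt_trans GD'.
have := GD (G / D); rewrite divr_gt0 //= ler_pdivrMr // mul1r ltW // => /(_ isT).
by rewrite divfK ?gt_eqF //; nra.
Qed.

(** For use with [S] the divergence vectors of half-space quantizers and [S'] those of their limits.
    The separating weights [u] are the positive parts of [c - y] at a mixture [y] nearest to the
    orthant. *)
Lemma maximin_alternative {R : realType} {n : nat} (S S' : set ('I_n.+1 -> R)) (c : R) :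
  S !=set0 ->
  (forall x : nat -> 'I_n.+1 -> R, (forall k, S (x k)) ->
     exists s, (forall k, k <= s k)%N /\
       exists2 y, S' y & forall i, x (s k) i @[k --> \oo] --> y i) ->
  (exists p (y : 'I_n.+1 -> 'I_n.+1 -> R), [/\ is_weight p, forall j, S' (y j)
     & forall i, c <= \sum_j p j * y j i]) \/
  (exists u : 'I_n.+1 -> R, exists b, [/\ forall i, 0 <= u i, 0 < \sum_i u i,
     b < c * \sum_i u i & forall x, S x -> \sum_i u i * x i <= b]).
Proof.
move=> [x0 Sx0] Sseq.
pose mix (p : 'I_n.+1 -> R) (x : 'I_n.+1 -> 'I_n.+1 -> R) i := \sum_j p j * x j i.
pose H := [set h | exists p x, [/\ is_weight p, forall j, S (x j) & h = shortfall c (mix p x)]].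
have H_ge0 h : H h -> 0 <= h.
  by move=> [p [x [_ _ ->]]]; apply: sumr_ge0 => i _; exact: sqr_ge0.
have Hinf : has_inf H.
  split; last by exists 0 => h /H_ge0.
  exists (shortfall c (mix (fun j => (j == ord0)%:R) (fun=> x0))).
  exists (fun j => (j == ord0)%:R), (fun=> x0); split=> //.
  split=> [j|]; first exact: ler0n.
  by rewrite (bigD1 ord0) //= big1 ?addr0 // => j /negbTE ->.
have step k : exists px : ('I_n.+1 -> R) * ('I_n.+1 -> 'I_n.+1 -> R),
    [/\ is_weight px.1, forall j, S (px.2 j)
      & shortfall c (mix px.1 px.2) < inf H + k.+1%:R^-1].
  have [|h [p [x [wp Sx ->]]] hlt] := @inf_adherent R H k.+1%:R^-1 _ Hinf.
    by rewrite invr_gt0.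
  by exists (p, x).
have [px pxP] := choice step.
have p_le1 k j : `|(px k).1 j| <= 1.
  have [[p_ge0 p1] _ _] := pxP k.
  by rewrite ger0_norm // -p1 (bigD1 j) //= lerDl sumr_ge0.
have [s1 [s1_ge [p pl]]] := bounded_cvg_subsequence_fin (fun k => (px k).1) 1 p_le1.
have [|j s s_ge|s2 [s2_ge s2P]] := @common_subsequence 'I_n.+1 (enum 'I_n.+1)
    (fun j s => exists2 y, S' y & forall i, (px (s1 (s k))).2 j i @[k --> \oo] --> y i).
- move=> j s t t_ge [y S'y sy]; exists y => // i.
  by apply: cvg_comp (sy i); exact: cvg_infty_ge_id.
- apply: (Sseq (fun k => (px (s1 (s k))).2 j)) => k.
  by have [_ /(_ j)] := pxP (s1 (s k)).
pose s k := s1 (s2 k).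
have s_ge k : (k <= s k)%N by exact: leq_trans (s2_ge k) (s1_ge _).
have [y yP] := choice (fun j => let: ex_intro2 y S'y sy := s2P j (mem_enum _ _) in
  ex_intro (fun y => S' y /\ forall i, (px (s k)).2 j i @[k --> \oo] --> y i) y (conj S'y sy)).
have pl' j : (px (s k)).1 j @[k --> \oo] --> p j.
  by apply: cvg_comp (pl j); exact: cvg_infty_ge_id.
have wp : is_weight p.
  split=> [j|].
    apply: cvgr_to_ge (pl' j) _; apply: nearW => k.
    by have [[+ _] _ _] := pxP (s k); apply.
  have : \sum_j (px (s k)).1 j @[k --> \oo] --> \sum_j p j.
    by apply: cvg_big => [|j _]; [exact: add_continuous | exact: pl'].
  under eq_fun => k do have [[_ ->] _ _] := pxP (s k).
  by move=> p1; apply: cvg_unique p1 (cvg_cst _).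
have mixl i : mix (px (s k)).1 (px (s k)).2 i @[k --> \oo] --> mix p y i.
  apply: cvg_big => [|j _]; first exact: add_continuous.
  by apply: cvgM; [exact: pl' | have [_] := yP j].
(* The limit mixes points of [S'], so its shortfall need not belong to [H]; as the limit of a
   minimizing sequence it is still at most [inf H]. *)
have h_le : shortfall c (mix p y) <= inf H.
  have infk : inf H + k.+1%:R^-1 @[k --> \oo] --> inf H.
    by rewrite -[X in _ --> X]addr0; apply: cvgD; [exact: cvg_cst | exact: cvg_harmonic].
  apply: ler_cvg_to (cvg_shortfall c _ _ mixl) infk _; apply: nearW => k.
  have [_ _ /ltW/le_trans->//] := pxP (s k).
  by rewrite lerD2l lef_pV2 ?posrE // ler_nat ltnS.
(* Moving towards [x] creates a mixture of one point too many; the reduction removes a point without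
   increasing the shortfall, so the value is at least [inf H]. This is done along the minimizing
   sequence, whose points lie in [S], and then passed to the limit. *)
have ymin x : S x -> forall t, 0 < t <= 1 ->
    shortfall c (mix p y) <= shortfall c (fun i => mix p y i + t * (x i - mix p y i)).
  move=> Sx t /andP[t0 t1].
  apply: cvgr_to_ge (cvg_shortfall c
    (fun k i => mix (px (s k)).1 (px (s k)).2 i +
                t * (x i - mix (px (s k)).1 (px (s k)).2 i)) _ _) _.
    move=> i; apply: cvgD; first exact: mixl.
    by apply: cvgM; [exact: cvg_cst | apply: cvgB; [exact: cvg_cst | exact: mixl]].
  apply: nearW => k; apply: le_trans h_le _.
  have [[p_ge0 p1] Spx _] := pxP (s k).
  pose x' (j : 'I_n.+2) := if unlift ord0 j is Some j' then (px (s k)).2 j' else x.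
  pose p' (j : 'I_n.+2) := if unlift ord0 j is Some j' then (1 - t) * (px (s k)).1 j' else t.
  have wp' : is_weight p'.
    split=> [j|].
      rewrite /p'; case: (unlift _ _) => [j'|]; last exact: ltW.
      by rewrite mulr_ge0 // subr_ge0.
    rewrite big_ord_recl {1}/p' unlift_none.
    under eq_bigr => j _ do rewrite /p' liftK.
    by rewrite -mulr_sumr p1 mulr1 addrC subrK.
  have [j0 [q [wq q_ge]]] := mixture_reduction x' p' wp'.
  have Hq : H (shortfall c (mix q (fun j => x' (lift j0 j)))).
    exists q, (fun j => x' (lift j0 j)); split=> // j.
    by rewrite /x'; case: (unlift _ _).
  apply: (le_trans (ge_inf (proj2 Hinf) Hq)); apply: shortfall_anti => i.
  apply: le_trans (q_ge i).
  rewrite big_ord_recl {1}/p' {1}/x' !unlift_none.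
  under eq_bigr => j _ do rewrite /p' /x' !liftK -mulrA.
  by rewrite -mulr_sumr -/(mix _ _ _) le_eqVlt; apply/orP; left; apply/eqP; ring.
pose u i := Num.max (c - mix p y i) 0.
have u_ge0 i : 0 <= u i by rewrite le_max lexx orbT.
have [u_gt0|u_le0] := ltP 0 (\sum_i u i); [right | left].
- exists u, (\sum_i u i * mix p y i); split=> // [|x Sx].
  (* The gap is the sum of [u i * (c - mix p y i)], which are the squares of the [u i]. *)
  + rewrite mulr_sumr -subr_gt0 -sumrB.
    rewrite lt_neqAle sumr_ge0 ?andbT => [|i _]; last first.
      by rewrite /u /Order.max; case: ltP => ?; nra.
    rewrite eq_sym psumr_neq0; last by move=> i _; rewrite /u /Order.max; case: ltP => ?; nra.
    apply: contraTT u_gt0 => /hasPn u0; rewrite -leNgt sumr_le0 // => i _.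
    have := u0 i (mem_index_enum _); rewrite /= -leNgt /u /Order.max; case: ltP => ?; nra.
  + rewrite -subr_le0 -sumrB; apply: le_trans (shortfall_first_order c _ _ (ymin x Sx)).
    by apply: ler_sum => i _; rewrite mulrBr.
- exists p, y; split=> // [j|i]; first by have [] := yP j.
  have : u i <= 0.
    by apply: le_trans u_le0; rewrite (bigD1 i) //= lerDl sumr_ge0.
  by rewrite ge_max subr_le0 => /andP[].
Qed.

(** * Kullback-Leibler divergence of quantized observations *)

(** This is [ln z <= z - 1] at [z = b * c / a]. Equality holds at [c = a / b]. *)
Lemma mul_ln_div_ge {R : realType} (a b c : R) : 0 < a -> 0 < b -> 0 < c ->
  a * (ln c + 1) - b * c <= a * ln (a / b).
Proof.
move=> a0 b0 c0.
have x0 : 0 < b * c / a by rewrite divr_gt0 ?mulr_gt0.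
have := @le_ln1Dx R (b * c / a - 1); rewrite ltrBrDl subrr => /(_ x0).
rewrite addrC subrK !ln_div ?posrE ?mulr_gt0 // lnM ?posrE // => h.
have := ler_wpM2l (ltW a0) h.
have -> : a * (b * c / a - 1) = b * c - a by field; rewrite gt_eqF.
lra.
Qed.

(** * Pointwise limits of quantizers *)

Section PointwiseLimits.
Context {R : realType} {d : measure_display} {T : measurableType d}.
Variable mu : {measure set T -> \bar R}.

Lemma measurable_quantizer (phi : T -> bool) u :
  is_quantizer phi -> measurable [set x | phi x = u].
Proof.
move=> mphi; case: u => //.
rewrite (_ : [set x | _] = ~` [set x | phi x]); first exact: measurableC.
by apply/seteqP; split=> x /=; case: (phi x).
Qed.

Lemma mem_quantizer (phi : T -> bool) u x : (x \in [set x | phi x = u]) = (phi x == u).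
Proof. by apply/idP/eqP; rewrite inE. Qed.

Lemma is_quantizer_lim (phi : nat -> T -> bool) (psi : T -> bool) :
  (forall k, is_quantizer (phi k)) ->
  (forall x, \forall k \near \oo, phi k x = psi x) -> is_quantizer psi.
Proof.
move=> mphi phipsi; rewrite /is_quantizer.
rewrite (_ : [set x | _] = \bigcup_n \bigcap_(k in [set k | (n <= k)%N]) [set x | phi k x]).
  apply: bigcup_measurable => n _; apply: bigcap_measurableType => k _; exact: mphi.
apply/seteqP; split=> x /=.
  move=> psix; have [N _ NP] := phipsi x.
  by exists N => // k Nk; rewrite /= (NP k).
move=> [n _ nP]; have [N _ NP] := phipsi x.
rewrite -(NP (maxn n N)) /= ?leq_maxr //; apply: nP; exact: leq_maxl.
Qed.

(** Dominated convergence with bound [|g|]: at each point the restricted integrands are eventually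
    constant. *)
Lemma cvg_integral_quantizer (g : T -> \bar R) (phi : nat -> T -> bool) (psi : T -> bool) u :
  mu.-integrable setT g ->
  (forall k, is_quantizer (phi k)) ->
  (forall x, \forall k \near \oo, phi k x = psi x) ->
  (\int[mu]_(x in [set x | phi k x = u]) g x)%E @[k --> \oo] -->
  (\int[mu]_(x in [set x | psi x = u]) g x)%E.
Proof.
move=> ig mphi phipsi.
have mpsi := is_quantizer_lim _ _ mphi phipsi.
have mg := measurable_int _ ig.
rewrite integral_mkcond.
under eq_fun do rewrite integral_mkcond.
have mr (A : set T) : measurable A -> measurable_fun setT (g \_ A).
  by move=> mA; apply/(measurable_restrictT _ mA); exact: measurable_funTS.
have [] // := @dominated_convergence d T R mu setT measurableT
  (fun k => g \_ [set x | phi k x = u]) (g \_ [set x | psi x = u]) (abse \o g).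
- by move=> k; apply: mr; exact: measurable_quantizer.
- by apply: mr; exact: measurable_quantizer.
- apply/aeW => x _; apply: cvg_near_cst.
  apply: filterS (phipsi x) => k kx.
  by rewrite /patch !mem_quantizer kx.
- exact: integrable_abse.
- apply/aeW => x k _; rewrite /patch; case: ifP => //= _.
  by rewrite normr0 abse_ge0.
Qed.

End PointwiseLimits.

(** * Probabilities, half-space events and integrability of the log-likelihood ratio *)

Section Densities.
Context {R : realType} {d : measure_display} {T : measurableType d}.
Context (mu : {measure set T -> \bar R}) {M : nat} (f : 'I_M -> T -> R).
Hypothesis f_meas : forall m, measurable_fun setT (f m).
Hypothesis f_ge0 : forall m x, 0 <= f m x.
Hypothesis f_int1 : forall m, (\int[mu]_x (f m x)%:E = 1)%E.

Lemma integrable_density m : mu.-integrable setT (EFin \o f m).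
Proof.
apply/integrableP; split; first exact/measurable_EFinP.
rewrite (eq_integral (EFin \o f m)); first by rewrite f_int1 ltry.
by move=> x _ /=; rewrite ger0_norm.
Qed.

Definition pr m (A : set T) : R := fine (Pm mu f m A).

Lemma PmE m A : measurable A -> Pm mu f m A = (pr m A)%:E.
Proof.
move=> mA; rewrite /pr fineK //; apply: integrable_fin_num => //.
by exact: integrableS (integrable_density m).
Qed.

Lemma pr_ge0 m A : 0 <= pr m A.
Proof. by apply: fine_ge0; apply: integral_ge0 => x _; rewrite lee_fin. Qed.

Lemma pr_setC m A : measurable A -> pr m A + pr m (~` A) = 1.
Proof.
move=> mA; have mAc := measurableC mA.
apply: EFin_inj; rewrite EFinD -!PmE //.
rewrite -(f_int1 m) -(setUv A) /Pm -integral_setU //.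
- by rewrite setUv; apply/measurable_EFinP.
- by rewrite disj_set2E setICr.
Qed.

Lemma integral_lincomb (a : 'I_M -> R) A : measurable A ->
  (\int[mu]_(x in A) (lincomb f a x)%:E)%E = (\sum_k a k * pr k A)%:E.
Proof.
move=> mA; under eq_integral do rewrite /lincomb -sumEFin.
rewrite integral_sum //; last first.
  move=> k; under eq_fun do rewrite EFinM.
  by apply: integrableZl => //; apply: integrableS (integrable_density k).
rewrite -sumEFin; apply: eq_bigr => k _.
under eq_integral do rewrite EFinM.
rewrite integralZl //; first by rewrite EFinM -PmE.
exact: integrableS (integrable_density k).
Qed.

Lemma measurable_lincomb (a : 'I_M -> R) : measurable_fun setT (lincomb f a).
Proof. by apply: measurable_sum => k; apply: measurable_funM => //; exact: measurable_cst. Qed.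

Lemma integrable_lincomb (a : 'I_M -> R) : mu.-integrable setT (EFin \o lincomb f a).
Proof.
rewrite (_ : EFin \o _ = fun x => (\sum_(k < M) (a k)%:E * (f k x)%:E)%E).
  apply: integrable_sum => // k _; apply: integrableZl => //; exact: integrable_density.
by apply/funext => x /=; rewrite /lincomb -sumEFin.
Qed.

Lemma is_quantizer_halfspace (a : 'I_M -> R) : is_quantizer (fun x => 0 < lincomb f a x).
Proof.
have mb : measurable_fun setT (fun x => 0 < lincomb f a x).
  by apply: measurable_fun_ltr; [exact: measurable_cst | exact: measurable_lincomb].
by have := mb measurableT [set true] I; rewrite setTI.
Qed.

(** The Neyman-Pearson argument: the integral of [lincomb f a] over an event is largest over the set
    where the integrand is positive. *)
Lemma halfspace_maximizes (a : 'I_M -> R) A : measurable A ->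
  \sum_k a k * pr k A <= \sum_k a k * pr k [set x | 0 < lincomb f a x].
Proof.
move=> mA; have mH := is_quantizer_halfspace a.
rewrite -lee_fin -!integral_lincomb // !(integral_mkcond _ (fun x => (lincomb f a x)%:E)).
apply: le_integral => //.
- by apply/(integrable_mkcond _ mA); apply: integrableS (integrable_lincomb a).
- by apply/(integrable_mkcond _ mH); apply: integrableS (integrable_lincomb a).
- move=> x _; rewrite /patch mem_quantizer.
  by case: (ltP 0) => a0; case: ifP => _; rewrite lee_fin // ltW.
Qed.

Section KullbackLeibler.
Variables m m' : 'I_M.
Hypothesis KL_fin : (KL mu f m m' < +oo)%E.

Lemma measurable_kl_integrand : measurable_fun setT (kl_integrand f m m').
Proof.
rewrite (_ : kl_integrand f m m' = fun x => if 0 < f m x then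
  (if 0 < f m' x then (f m x * (ln (f m x) - ln (f m' x)))%:E else +oo%E) else 0%E).
  have pos k : measurable_fun setT (fun x => 0 < f k x).
    by apply: measurable_fun_ltr => //; exact: measurable_cst.
  apply: measurable_fun_ifT => //; apply: measurable_fun_ifT => //.
  apply/measurable_EFinP; apply: measurable_funM => //.
  by apply: measurable_funB; apply: (measurableT_comp (@measurable_ln R)).
apply/funext => x; rewrite /kl_integrand; case: ifP => // fm; case: ifP => // fm'.
by rewrite ln_div.
Qed.

(* Linearization of (a, b) |-> a ln (a / b) at a / b = c; c is left free so that
   its integral yields both absolute continuity (c -> oo) and the log-sum inequality. *)
Lemma kl_integrand_ge (c : R) x : 0 < c ->
  ((f m x * (ln c + 1) - f m' x * c)%:E <= kl_integrand f m m' x)%E.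
Proof.
move=> c0; rewrite /kl_integrand; case: ifPn => [fm|].
  case: ifPn => [fm'|_]; last exact: leey.
  by rewrite lee_fin; exact: mul_ln_div_ge.
rewrite -leNgt => fm; have -> : f m x = 0 by apply/le_anti; rewrite fm f_ge0.
by rewrite mul0r sub0r lee_fin oppr_le0 mulr_ge0 // ltW.
Qed.

(** The tangent at [c = 1] bounds the negative part by [f m'], which has integral 1; finiteness of
    the divergence then bounds the positive part. *)
Lemma integrable_kl_integrand : mu.-integrable setT (kl_integrand f m m').
Proof.
set kl := kl_integrand f m m'.
have mkl : measurable_fun setT kl := measurable_kl_integrand.
have neg_fin : (\int[mu]_x kl^\- x < +oo)%E.
  apply: (@le_lt_trans _ _ (\int[mu]_x (f m' x)%:E)%E); last by rewrite f_int1 ltry.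
  apply: ge0_le_integral => //.
  - exact: measurable_funeneg.
  - exact/measurable_EFinP.
  - move=> x _; rewrite funenegE ge_max lee_fin f_ge0 andbT leeNl.
    apply: le_trans (kl_integrand_ge 1 x ltr01).
    by rewrite ln1 add0r !mulr1 lee_fin lerBrDl subrr f_ge0.
have pos_fin : (\int[mu]_x kl^\+ x < +oo)%E.
  have := KL_fin; rewrite /KL integralE -/kl.
  have : (\int[mu]_x kl^\- x \is a fin_num)%E by rewrite ge0_fin_numE // integral_ge0.
  by case: (\int[mu]_x kl^\- x)%E => // r _; case: (\int[mu]_x kl^\+ x)%E => // r' _; rewrite ltry.
apply/integrableP; split=> //.
under eq_integral do rewrite -[(fun x => `|kl x|)%E _]/((abse \o kl) _) fune_abse.
rewrite ge0_integralD //; first exact: lte_add_pinfty.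
- exact: measurable_funepos.
- exact: measurable_funeneg.
Qed.

Definition kl_on (A : set T) : R := fine (\int[mu]_(x in A) kl_integrand f m m' x)%E.

Lemma kl_onE A : measurable A -> (\int[mu]_(x in A) kl_integrand f m m' x)%E = (kl_on A)%:E.
Proof.
move=> mA; rewrite /kl_on fineK //; apply: integrable_fin_num => //.
exact: integrableS integrable_kl_integrand.
Qed.

Lemma kl_on_ge A (c : R) : measurable A -> 0 < c ->
  pr m A * (ln c + 1) - pr m' A * c <= kl_on A.
Proof.
move=> mA c0; rewrite -lee_fin -kl_onE //.
have i1 : mu.-integrable A (fun x => (f m x)%:E * (ln c + 1)%:E)%E.
  by apply: integrableZr => //; apply: integrableS (integrable_density m).
have i2 : mu.-integrable A (fun x => (f m' x)%:E * c%:E)%E.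
  by apply: integrableZr => //; apply: integrableS (integrable_density m').
have -> : (pr m A * (ln c + 1) - pr m' A * c)%:E =
    (\int[mu]_(x in A) ((f m x)%:E * (ln c + 1)%:E - (f m' x)%:E * c%:E))%E.
  rewrite integralB // !integralZr //.
  - by rewrite EFinB !EFinM -!PmE.
  - exact: integrableS (integrable_density m').
  - exact: integrableS (integrable_density m).
apply: le_integral => //.
- exact: integrableB.
- exact: integrableS integrable_kl_integrand.
- by move=> x _; rewrite -!EFinM -EFinB; exact: kl_integrand_ge.
Qed.

(** Absolute continuity: with [p = pr m A > 0], [K = kl_on A] and [pr m' A = 0], the tangent bound
    at [c = exp (K / p)] would read [K + p <= K]. *)
Lemma pr_dominated A : measurable A -> pr m' A = 0 -> pr m A = 0.
Proof.
move=> mA pr0; apply/eqP; rewrite eq_le pr_ge0 andbT leNgt; apply/negP => p0.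
have := kl_on_ge A (expR (kl_on A / pr m A)) mA (expR_gt0 _).
rewrite pr0 mul0r subr0 expRK mulrDr mulrCA divff ?gt_eqF // !mulr1.
by rewrite -lerBrDl subrr leNgt p0.
Qed.

Lemma kl_on_null A : measurable A -> pr m A = 0 -> kl_on A = 0.
Proof.
move=> mA p0; apply: EFin_inj; rewrite -kl_onE //.
have f0 : ae_eq mu A (EFin \o f m) (cst 0%E).
  have mf : measurable_fun A (EFin \o f m).
    by apply/measurable_EFinP; exact: measurable_funTS.
  apply: (@ae_eq_integral_abs d T R mu A mA _ mf).1.
  under eq_integral do rewrite /= ger0_norm //.
  by rewrite -/(Pm mu f m A) PmE // p0.
rewrite (ae_eq_integral (cst 0%E)) ?integral0 //.
- by apply: measurable_funTS; exact: measurable_kl_integrand.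
- apply: filterS f0 => x /= fx Ax; have [f0] := fx Ax.
  by rewrite /kl_integrand f0 ltxx.
Qed.

End KullbackLeibler.

Lemma kl_on_setC m m' A : (KL mu f m m' < +oo)%E -> measurable A ->
  kl_on m m' A + kl_on m m' (~` A) = kl_on m m' setT.
Proof.
move=> KLf mA; have mAc := measurableC mA.
apply: EFin_inj; rewrite EFinD -!kl_onE // -(setUv A) -integral_setU //.
- by rewrite setUv; exact: measurable_kl_integrand.
- by rewrite disj_set2E setICr.
Qed.

End Densities.

(** * Bounds, continuity and half-space improvement for quantized divergences *)

Section Divergence.
Context {R : realType} {d : measure_display} {T : measurableType d}.
Context (mu : {measure set T -> \bar R}) {M : nat} (f : 'I_M -> T -> R).
Hypothesis f_meas : forall m, measurable_fun setT (f m).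
Hypothesis f_ge0 : forall m x, 0 <= f m x.
Hypothesis f_int1 : forall m, (\int[mu]_x (f m x)%:E = 1)%E.
Hypothesis KL_fin : forall m m', m != m' -> (KL mu f m m' < +oo)%E.

Local Notation pr := (pr mu f).
Local Notation halfspace a := (fun x => 0 < lincomb f a x).

Let pr0 m m' A : measurable A -> pr m' A = 0 -> pr m A = 0.
Proof.
have [<-//|mm'] := eqVneq m m'.
by apply: pr_dominated => //; exact: KL_fin.
Qed.

(** A real-valued form of [klterm]. The two differ only for [q = 0 < p], which domination
    excludes. *)
Definition klr (p q : R) : R := p * ln (p / q).

Lemma klr_ge (p q c : R) : 0 <= p -> 0 <= q -> (q = 0 -> p = 0) -> 0 < c ->
  p * (ln c + 1) - q * c <= klr p q.
Proof.
move=> p_ge0 q_ge0 pq c0; have [p0|p0] := eqVneq p 0.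
  by rewrite /klr p0 !mul0r sub0r oppr_le0 mulr_ge0 // ltW.
have q0 : q != 0 by apply: contra_neq p0.
by apply: mul_ln_div_ge => //; rewrite lt_neqAle eq_sym ?p0 ?q0.
Qed.

Definition qprob m (phi : T -> bool) u : R := pr m [set x | phi x = u].

Definition div m m' (phi : T -> bool) : R :=
  klr (qprob m phi false) (qprob m' phi false) + klr (qprob m phi true) (qprob m' phi true).

Lemma qprob_ge0 m phi u : 0 <= qprob m phi u.
Proof. exact: pr_ge0. Qed.

Lemma qprob_false m phi : is_quantizer phi -> qprob m phi false = 1 - qprob m phi true.
Proof.
move=> mphi; have <- := pr_setC mu f f_meas f_ge0 f_int1 m _ mphi.
rewrite /qprob addrAC subrr add0r.
by congr (pr m _); apply/seteqP; split=> x /=; case: (phi x).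
Qed.

Lemma qprob_dominated m m' phi u :
  is_quantizer phi -> qprob m' phi u = 0 -> qprob m phi u = 0.
Proof. by move=> mphi; apply: pr0; exact: measurable_quantizer. Qed.

Lemma qklr_ge m m' phi u (c : R) : is_quantizer phi -> 0 < c ->
  qprob m phi u * (ln c + 1) - qprob m' phi u * c <= klr (qprob m phi u) (qprob m' phi u).
Proof.
move=> mphi c0; apply: klr_ge => //; try exact: qprob_ge0.
exact: qprob_dominated.
Qed.

Lemma qklr_geB m m' phi u : is_quantizer phi ->
  qprob m phi u - qprob m' phi u <= klr (qprob m phi u) (qprob m' phi u).
Proof.
move=> mphi; have := qklr_ge m m' phi u 1 mphi ltr01.
by rewrite ln1 add0r !mulr1.
Qed.

(** The log-sum inequality: with [c] the ratio of the two probabilities of the event, the tangent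
    bound for [kl_on] has [klr] as its left side. *)
Lemma qklr_le m m' phi u : is_quantizer phi -> m != m' ->
  klr (qprob m phi u) (qprob m' phi u) <= kl_on mu f m m' [set x | phi x = u].
Proof.
move=> mphi mm'; have mA := measurable_quantizer phi u mphi.
have [p0|p0] := eqVneq (qprob m phi u) 0.
  by rewrite (kl_on_null mu f f_meas f_ge0 f_int1 _ _ (KL_fin _ _ mm')) // /klr p0 mul0r.
have q0 : qprob m' phi u != 0 by apply: contra_neq p0; exact: qprob_dominated.
have {}p0 : 0 < qprob m phi u by rewrite lt_neqAle eq_sym p0 qprob_ge0.
have {}q0 : 0 < qprob m' phi u by rewrite lt_neqAle eq_sym q0 qprob_ge0.
have := kl_on_ge mu f f_meas f_ge0 f_int1 m m' (KL_fin _ _ mm') _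
  (qprob m phi u / qprob m' phi u) mA.
rewrite divr_gt0 // => /(_ isT); rewrite -/(qprob m phi u) -/(qprob m' phi u).
rewrite mulrDr mulr1 [qprob m' _ _ * _]mulrC divfK ?gt_eqF //.
by rewrite addrK.
Qed.

(** Each term is at least the difference of the two probabilities of its message, and these
    differences add up to 0. *)
Lemma div_ge0 m m' phi : is_quantizer phi -> 0 <= div m m' phi.
Proof.
move=> mphi; rewrite /div.
have := qklr_geB m m' phi true mphi; have := qklr_geB m m' phi false mphi.
by rewrite !(qprob_false _ phi) //; lra.
Qed.

Lemma div_le m m' phi : is_quantizer phi -> m != m' ->
  div m m' phi <= kl_on mu f m m' setT.
Proof.
move=> mphi mm'.
rewrite -(kl_on_setC mu f f_meas f_ge0 f_int1 _ _ _ (KL_fin _ _ mm') mphi) addrC.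
apply: lerD; last exact: qklr_le.
rewrite (_ : ~` [set x | phi x] = [set x | phi x = false]); first exact: qklr_le.
by apply/seteqP; split=> x /=; case: (phi x).
Qed.

Lemma div_trivial m m' phi u :
  is_quantizer phi -> qprob m phi u = 0 -> div m m' phi = 0.
Proof.
move=> mphi p0; have q0 := qprob_dominated m' m phi u mphi p0.
have k0 : klr 0 0 = 0 by rewrite /klr mul0r.
have k1 : klr 1 1 = 0 by rewrite /klr divr1 ln1 mulr0.
rewrite /div !(qprob_false _ phi) //; case: u p0 q0 => [-> ->|].
  by rewrite !subr0 k0 k1 addr0.
rewrite !(qprob_false _ phi) // => p0 q0; rewrite p0 q0.
move/eqP: p0; rewrite subr_eq0 => /eqP <-; move/eqP: q0; rewrite subr_eq0 => /eqP <-.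
by rewrite k0 k1 addr0.
Qed.

Lemma IdetE m m' phi : is_quantizer phi -> Idet mu f m m' phi = (div m m' phi)%:E.
Proof.
move=> mphi.
have E u : klterm (fq mu f m phi u) (fq mu f m' phi u) =
    (klr (qprob m phi u) (qprob m' phi u))%:E.
  rewrite /klterm -/(qprob m phi u) -/(qprob m' phi u) /klr.
  have [->|p0] := eqVneq (qprob m phi u) 0; first by rewrite mul0r.
  have [q0|//] := eqVneq (qprob m' phi u) 0.
  by case/eqP: p0; exact: qprob_dominated q0.
by rewrite /Idet !E.
Qed.

Lemma cvg_div m m' (phi : nat -> T -> bool) (psi : T -> bool) : m != m' ->
  (forall k, is_quantizer (phi k)) ->
  (forall x, \forall k \near \oo, phi k x = psi x) ->
  div m m' (phi k) @[k --> \oo] --> div m m' psi.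
Proof.
move=> mm' mphi phipsi; have mpsi := is_quantizer_lim _ _ mphi phipsi.
have cp k u : qprob k (phi j) u @[j --> \oo] --> qprob k psi u.
  have := cvg_integral_quantizer mu _ phi psi u (integrable_density mu f f_meas f_ge0 f_int1 k) mphi phipsi.
  rewrite -/(Pm mu f k _) PmE //; last exact: measurable_quantizer.
  exact: fine_cvg.
have ck u : kl_on mu f m m' [set x | phi j x = u] @[j --> \oo] -->
    kl_on mu f m m' [set x | psi x = u].
  have := cvg_integral_quantizer mu _ phi psi u
    (integrable_kl_integrand mu f f_meas f_ge0 f_int1 m m' (KL_fin _ _ mm')) mphi phipsi.
  rewrite [X in _ --> X -> _]kl_onE //; first exact: fine_cvg.
  - exact: KL_fin.
  - exact: measurable_quantizer.
suff ckl u : klr (qprob m (phi j) u) (qprob m' (phi j) u) @[j --> \oo] -->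
    klr (qprob m psi u) (qprob m' psi u) by apply: cvgD.
have [p0|p0] := eqVneq (qprob m psi u) 0; last first.
  have q0 : qprob m' psi u != 0 by apply: contra_neq p0; exact: qprob_dominated.
  have pq : 0 < qprob m psi u / qprob m' psi u.
    by rewrite divr_gt0 // lt_neqAle eq_sym ?p0 ?q0 qprob_ge0.
  have pqj : qprob m (phi j) u / qprob m' (phi j) u @[j --> \oo] -->
      qprob m psi u / qprob m' psi u by apply: cvgM => //; exact: cvgV.
  rewrite /klr; apply: cvgM => //.
  exact: cvg_comp pqj (continuous_ln pq).
(* Both probabilities tend to 0, where [klr] is not continuous. It is squeezed between their
   difference and the share of the full divergence on the event, and both bounds tend to 0. *)
have q0 := qprob_dominated m' m psi u mpsi p0.
have kp : klr (qprob m psi u) (qprob m' psi u) = 0 by rewrite p0 /klr mul0r.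
have up : kl_on mu f m m' [set x | phi j x = u] @[j --> \oo] --> 0.
  rewrite -(kl_on_null mu f f_meas f_ge0 f_int1 _ _ (KL_fin _ _ mm') _ _ p0) //.
  exact: measurable_quantizer.
have lo : qprob m (phi j) u - qprob m' (phi j) u @[j --> \oo] --> 0.
  by rewrite -(subr0 0) -{1}p0 -q0; apply: cvgB.
rewrite kp; apply: squeeze_cvgr lo up; apply: nearW => j.
by rewrite qklr_geB // qklr_le.
Qed.

(* The divergence is convex in the vector of probabilities of the event phi = true,
   so its first-order expansion at phi minorizes it; the expansion is linear,
   and a half-space of the likelihoods maximizes it. *)
Lemma halfspace_improves m {n : nat} (h : 'I_n -> 'I_M) (u : 'I_n -> R) phi :
  (forall i, 0 <= u i) -> is_quantizer phi ->
  exists a, (exists k, a k != 0) /\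
    \sum_i u i * div m (h i) phi <= \sum_i u i * div m (h i) (halfspace a).
Proof.
move=> u_ge0 mphi.
have mH a : is_quantizer (halfspace a) by exact: is_quantizer_halfspace.
(* If a message has probability 0, all divergences of [phi] vanish and any half-space does at least
   as well; all-ones coefficients give a nonzero normal. *)
have [[v p0]|pn0] := pselect (exists v, qprob m phi v = 0).
  exists (fun=> 1); split; first by exists m; exact: oner_neq0.
  rewrite big1 => [|i _]; last by rewrite (div_trivial m (h i) phi v) // mulr0.
  by apply: sumr_ge0 => i _; rewrite mulr_ge0 // div_ge0.
have p_gt0 k v : 0 < qprob k phi v.
  rewrite lt_neqAle qprob_ge0 andbT eq_sym; apply/eqP => p0; apply: pn0; exists v.
  exact: qprob_dominated p0.
pose b i v := qprob m phi v / qprob (h i) phi v.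
have b_gt0 i v : 0 < b i v by rewrite divr_gt0.
(* [A i] and [- B i] are the partial derivatives of the i-th divergence in the probabilities of
   [phi = true] under [m] and [h i]; [a] collects them with weights [u]. *)
pose A i := ln (b i true) - ln (b i false); pose B i := b i true - b i false.
pose a k := \sum_i u i * (A i * (k == m)%:R - B i * (k == h i)%:R).
have delta j (F : 'I_M -> R) : \sum_k (k == j)%:R * F k = F j.
  rewrite (bigD1 j) //= eqxx mul1r big1 ?addr0 // => k /negbTE ->.
  by rewrite mul0r.
have aE psi : \sum_k a k * qprob k psi true =
    \sum_i u i * (A i * qprob m psi true - B i * qprob (h i) psi true).
  rewrite /a; under eq_bigr => k _ do rewrite mulr_suml.
  rewrite exchange_big /=; apply: eq_bigr => i _.
  rewrite -(delta m (fun k => qprob k psi true)) -(delta (h i) (fun k => qprob k psi true)).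
  rewrite !mulr_sumr -sumrB mulr_sumr; apply: eq_bigr => k _; ring.
have key psi : is_quantizer psi ->
    \sum_k a k * qprob k phi true <= \sum_k a k * qprob k psi true ->
    \sum_i u i * div m (h i) phi <= \sum_i u i * div m (h i) psi.
  move=> mpsi; rewrite !aE -subr_ge0 -sumrB => le_a.
  rewrite -subr_ge0 -sumrB; apply: (le_trans le_a).
  apply: ler_sum => i _; rewrite -!mulrBr; apply: ler_wpM2l => //.
  have := qklr_ge m (h i) psi true _ mpsi (b_gt0 i true).
  have := qklr_ge m (h i) psi false _ mpsi (b_gt0 i false).
  have phiE v : klr (qprob m phi v) (qprob (h i) phi v) = qprob m phi v * ln (b i v) by [].
  have bE v : qprob m phi v = b i v * qprob (h i) phi v by rewrite /b divfK // gt_eqF.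
  rewrite /div !phiE /A /B; have := bE true; have := bE false.
  rewrite !(qprob_false _ psi) // !(qprob_false _ phi) //.
  move=> e1 e2; move: e1; rewrite e2; nra.
have [[k ak]|a0] := pselect (exists k, a k != 0).
  exists a; split; first by exists k.
  by apply: key => //; exact: halfspace_maximizes.
(* With a zero gradient the expansion is constant, so [phi] is a minimizer and again any half-space
   will do. *)
exists (fun=> 1); split; first by exists m; exact: oner_neq0.
apply: key => //; rewrite !big1 // => k _.
  by case: (eqVneq (a k) 0) => [->|ak]; [rewrite mul0r | case: a0; exists k].
by case: (eqVneq (a k) 0) => [->|ak]; [rewrite mul0r | case: a0; exists k].
Qed.

(** The two quantizers can differ only where [lincomb f g] vanishes, and there [f m] is zero almost
    everywhere. *)
Lemma qprob_ULQ (g : 'I_M -> R) (psi : T -> bool) m u : is_quantizer psi ->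
  Pm mu f m [set x | lincomb f g x = 0] = 0%E ->
  (forall x, lincomb f g x != 0 -> psi x = (0 < lincomb f g x)) ->
  qprob m psi u = qprob m (halfspace g) u.
Proof.
move=> mpsi g0 psig; rewrite /qprob /pr /Pm; congr fine.
have mH : is_quantizer (halfspace g) by exact: is_quantizer_halfspace.
have mA := measurable_quantizer _ u mpsi; have mB := measurable_quantizer _ u mH.
have mf : measurable_fun setT (EFin \o f m) by apply/measurable_EFinP.
have mN : measurable [set x | lincomb f g x = 0].
  rewrite -[X in measurable X]setTI -[X in _ `&` X]/(lincomb f g @^-1` [set 0]).
  by apply: measurable_lincomb.
have f0 : ae_eq mu [set x | lincomb f g x = 0] (EFin \o f m) (cst 0%E).
  apply: (@ae_eq_integral_abs d T R mu _ mN _ (measurable_funTS mf)).1.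
  by under eq_integral do rewrite /= ger0_norm //.
rewrite integral_mkcond [RHS]integral_mkcond; apply: ae_eq_integral => //.
- by apply/(measurable_restrictT _ mA); exact: measurable_funTS.
- by apply/(measurable_restrictT _ mB); exact: measurable_funTS.
apply: filterS f0 => x fx _; rewrite /patch !mem_quantizer.
have [gx|gx] := eqVneq (lincomb f g x) 0; last by rewrite psig.
by have /= -> := fx gx; rewrite !if_same.
Qed.

Lemma halfspace_compact m (a : nat -> 'I_M -> R) :
  (forall k, exists i, a k i != 0) ->
  exists s, (forall k, k <= s k)%N /\ exists psi,
    [/\ is_quantizer psi, lin_indep_densities mu f -> is_ULQ mu f psi
      & forall m', m != m' ->
          div m m' (halfspace (a (s k))) @[k --> \oo] --> div m m' psi].
Proof.
move=> an0.
have [s [s_ge [g [gsgn gcst gn0]]]] := halfspace_subsequence a.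
(* [lincomb f a x] is [dotp a] at the likelihood vector of [x], so convergence at all vectors yields
   a limit quantizer at all observations. *)
have [psi psiP] := choice (fun x => gcst (fun i => f i x)).
have mH c : is_quantizer (halfspace c) by exact: is_quantizer_halfspace.
have lim k (mk : m != k) :=
  cvg_div m k (fun j => halfspace (a (s j))) psi mk (fun=> mH _) psiP.
have mpsi := is_quantizer_lim _ _ (fun k => mH (a (s k))) psiP.
exists s; split=> //.
(* On the hyperplane of [g] the limit [psi] need not follow a half-space. Under linear independence
   this hyperplane has probability 0, and the half-space of [g] replaces [psi] with the same
   divergences. *)
have [li|nli] := pselect (lin_indep_densities mu f); last first.
  by exists psi; split=> // m' mm'; exact: lim.
have g0 := li g (gn0 an0).
exists (halfspace g); split=> //; first by move=> _; exists g.
move=> m' mm'; rewrite (_ : div m m' (halfspace g) = div m m' psi); first exact: lim.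
have psig x : lincomb f g x != 0 -> psi x = (0 < lincomb f g x).
  move=> /gsgn near_g; have [N _ /(_ N (leqnn N))] := filterI near_g (psiP x).
  by move=> [<- <-].
by rewrite /div !(qprob_ULQ g psi).
Qed.

End Divergence.

(** * Randomized quantizers *)

Lemma nneseries_finite {R : realType} (F : nat -> \bar R) n :
  (forall j, (n <= j)%N -> F j = 0%E) ->
  (\sum_(0 <= j <oo) F j = \sum_(j < n) F j)%E.
Proof.
move=> F0; apply: cvg_lim => //; apply: cvg_near_cst.
exists n => // k /= nk.
rewrite (big_cat_nat (n := n)) //= big_mkord [X in (_ + X)%E]big_nat_cond [X in (_ + X)%E]big1 ?adde0 // => j.
by rewrite andbT => /andP[/F0].
Qed.

Lemma series_finite_cvg {R : realType} (w : nat -> R) n :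
  (forall j, (n <= j)%N -> w j = 0) ->
  (fun k => \sum_(0 <= j < k) w j) @ \oo --> \sum_(j < n) w j.
Proof.
move=> w0; apply: cvg_near_cst; exists n => // k /= nk.
rewrite (big_cat_nat (n := n)) //= big_mkord [X in _ + X]big_nat_cond [X in _ + X]big1 ?addr0 // => j.
by rewrite andbT => /andP[/w0].
Qed.

Lemma is_quantizer_false {d : measure_display} {T : measurableType d} :
  is_quantizer (fun _ : T => false).
Proof.
rewrite /is_quantizer (_ : [set x | _] = set0) //.
by apply/seteqP; split=> x.
Qed.

Section Maximin.
Context {R : realType} {d : measure_display} {T : measurableType d}.
Context (mu : {measure set T -> \bar R}) {M : nat} (f : 'I_M -> T -> R).
Hypothesis f_meas : forall m, measurable_fun setT (f m).
Hypothesis f_ge0 : forall m x, 0 <= f m x.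
Hypothesis f_int1 : forall m, (\int[mu]_x (f m x)%:E = 1)%E.
Hypothesis KL_fin : forall m m', m != m' -> (KL mu f m m' < +oo)%E.

Local Notation div := (div mu f).
Let divE := IdetE mu f f_meas f_ge0 f_int1 KL_fin.
Let div_ge0 := div_ge0 mu f f_meas f_ge0 f_int1 KL_fin.

Lemma Irq_ge0 m q : is_rquant q -> (0 <= Irq mu f m q)%E.
Proof.
move=> [w_ge0 [mphi _]]; apply/ereal_infP => _ [m' /= _ <-].
apply: nneseries_ge0 => j _ _; rewrite divE // -EFinM lee_fin.
by rewrite mulr_ge0 // div_ge0.
Qed.

(** Weak duality: the minimum over alternatives is at most their [u]-weighted average, and
    exchanging the sums makes this an average over [j] of quantities at most [b]. *)
Lemma Irq_le m {n : nat} (h : 'I_n -> 'I_M) (u : 'I_n -> R) (b : R) q :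
  is_rquant q -> (forall i, h i != m) -> (forall i, 0 <= u i) -> 0 < \sum_i u i ->
  (forall phi, is_quantizer phi -> \sum_i u i * div m (h i) phi <= b) ->
  (Irq mu f m q <= (b / \sum_i u i)%:E)%E.
Proof.
move=> rq hm u_ge0 u_gt0 ub; have Iq_ge0 := Irq_ge0 m q rq.
have [w_ge0 [mphi w1]] := rq.
have D_ge0 i j : (0 <= (rq_w q j)%:E * Idet mu f m (h i) (rq_phi q j))%E.
  by rewrite divE // -EFinM lee_fin mulr_ge0 // div_ge0.
have b_ge0 : 0 <= b.
  by apply: le_trans (ub _ (mphi 0%N)); apply: sumr_ge0 => i _; rewrite mulr_ge0 // div_ge0.
have H : ((\sum_i u i)%:E * Irq mu f m q <= b%:E)%E.
  rewrite -sumEFin ge0_sume_distrl => [|i _]; last by rewrite lee_fin.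
  apply: (@le_trans _ _ (\sum_(i < n) (u i)%:E * Ipair mu f m (h i) q)%E).
    apply: lee_sum => i _; apply: lee_wpmul2l; first by rewrite lee_fin.
    by apply: ereal_inf_lbound; exists (h i); [exact: hm|].
  rewrite /Ipair; under eq_bigr => i _ do rewrite -nneseriesZl //.
  rewrite -nneseries_sum => [|i j _]; last by rewrite mule_ge0 // lee_fin.
  (* As the randomization weights sum to 1, [b] is spread over them so that the series compare
     termwise. *)
  have -> : b%:E = (\sum_(0 <= j <oo) b%:E * (rq_w q j)%:E)%E.
    rewrite nneseriesZl => [|j _]; last by rewrite lee_fin.
    have -> : (\sum_(0 <= j <oo) (rq_w q j)%:E = 1)%E.
      apply: cvg_lim => //.
      under eq_fun do rewrite sumEFin.
      by apply: cvg_EFin w1; apply: nearW.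
    by rewrite mule1.
  apply: lee_nneseries => [j _ _|j _].
    by apply: sume_ge0 => i _; rewrite mule_ge0 // lee_fin.
  have -> : (\sum_(i < n) (u i)%:E * ((rq_w q j)%:E * Idet mu f m (h i) (rq_phi q j)) =
      (rq_w q j * \sum_i u i * div m (h i) (rq_phi q j))%:E)%E.
    rewrite mulr_sumr -sumEFin; apply: eq_bigr => i _.
    by rewrite divE // -!EFinM mulrCA.
  by rewrite -EFinM lee_fin mulrC ler_wpM2r // ub.
move: H Iq_ge0; case: (Irq mu f m q) => [r| |] //=.
- by rewrite -EFinM !lee_fin ler_pdivlMr // mulrC.
- by rewrite gt0_muley ?lte_fin.
Qed.

Definition finite_rquant {n : nat} (p : 'I_n -> R) (psi : 'I_n -> T -> bool) : @rquant R d T :=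
  RQuant (fun j => oapp p 0 (insub j)) (fun j => oapp psi (fun=> false) (insub j)).

Lemma is_rquant_finite {n : nat} (p : 'I_n -> R) (psi : 'I_n -> T -> bool) :
  is_weight p -> (forall j, is_quantizer (psi j)) -> is_rquant (finite_rquant p psi).
Proof.
move=> [p_ge0 p1] mpsi; split; [|split] => /=.
- by move=> j; case: insub => //=.
- by move=> j; case: insub => //=; exact: is_quantizer_false.
- have w0 j : (n <= j)%N -> oapp p 0 (insub j) = 0.
    by move=> nj; rewrite insubF // ltnNge nj.
  have := series_finite_cvg _ n w0.
  by under eq_bigr => j _ do rewrite valK; rewrite p1.
Qed.

Lemma Ipair_finite m m' {n : nat} (p : 'I_n -> R) (psi : 'I_n -> T -> bool) :
  (forall j, is_quantizer (psi j)) ->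
  Ipair mu f m m' (finite_rquant p psi) = (\sum_j p j * div m m' (psi j))%:E.
Proof.
move=> mpsi; rewrite /Ipair /= (nneseries_finite _ n) => [|j nj]; last first.
  by rewrite insubF ?mul0e // ltnNge nj.
rewrite -sumEFin; apply: eq_bigr => j _.
by rewrite valK /= divE // EFinM.
Qed.

Lemma exists_maximin m {n : nat} (h : 'I_n.+1 -> 'I_M) :
  (forall m', (m' != m) <-> exists i, h i = m') ->
  exists p (psi : 'I_n.+1 -> T -> bool), [/\ is_weight p,
    is_maximin mu f m (finite_rquant p psi)
    & lin_indep_densities mu f -> forall j, is_ULQ mu f (psi j)].
Proof.
move=> hP; have hm i : h i != m by apply/hP; exists i.
have mh i : m != h i by rewrite eq_sym.
pose phi0 : T -> bool := fun=> false.
have mphi0 : is_quantizer phi0 by exact: is_quantizer_false.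
pose e0 (i : 'I_n.+1) : R := (i == ord0)%:R.
have e01 : \sum_i e0 i = 1.
  by rewrite /e0 (bigD1 ord0) //= big1 ?addr0 // => i /negbTE ->.
have we0 : is_weight e0 by split=> // i; exact: ler0n.
(* The alternative needs a real threshold. The upper bound is the unquantized divergence from the
   single state [h ord0], obtained from unit weight on it. *)
have [c cE] : exists c, Imax mu f m = c%:E.
  have Imax_ge0 : (0 <= Imax mu f m)%E.
    have rq0 := is_rquant_finite e0 (fun=> phi0) we0 (fun=> mphi0).
    apply: le_trans (Irq_ge0 m _ rq0) _.
    by apply: ereal_sup_ubound; exists (finite_rquant e0 (fun=> phi0)).
  have Imax_le : (Imax mu f m <= (kl_on mu f m (h ord0) setT)%:E)%E.
    apply/ereal_supP => _ [q rq <-].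
    rewrite -[kl_on _ _ _ _ _]divr1 -e01; apply: Irq_le => //; rewrite ?e01 //.
    move=> phi mphi; rewrite (bigD1 ord0) //= big1 => [|i /negbTE i0]; last first.
      by rewrite /e0 i0 mul0r.
    by rewrite addr0 /e0 eqxx mul1r; apply: div_le.
  by case: (Imax mu f m) Imax_ge0 Imax_le => // c; exists c.
pose S := [set v : 'I_n.+1 -> R | exists a, (exists k, a k != 0) /\
  v = fun i => div m (h i) (fun x => 0 < lincomb f a x)].
pose S' := [set v : 'I_n.+1 -> R | exists psi, [/\ is_quantizer psi,
  lin_indep_densities mu f -> is_ULQ mu f psi & v = fun i => div m (h i) psi]].
have [||[p [y [wp S'y cy]]]|[u [b [u_ge0 u_gt0 bc Sb]]]] := maximin_alternative S S' c.
- exists (fun i => div m (h i) (fun x => 0 < lincomb f (fun=> 1) x)), (fun=> 1).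
  by split=> //; exists m; exact: oner_neq0.
- move=> x Sx; have [a aP] := choice Sx.
  have [|s [s_ge [psi [mpsi Upsi psilim]]]] :=
    halfspace_compact mu f f_meas f_ge0 f_int1 KL_fin m a.
    by move=> k; have [] := aP k.
  exists s; split=> //; exists (fun i => div m (h i) psi); first by exists psi.
  move=> i; have := psilim (h i) (mh i).
  apply: cvg_trans; apply: near_eq_cvg; apply: nearW => k.
  by have [_ ->] := aP (s k).
- have [psi psiP] := choice S'y.
  have mpsi j : is_quantizer (psi j) by have [] := psiP j.
  exists p, psi; split=> //; last first.
    by move=> li j; have [_ + _] := psiP j; apply.
  have rq := is_rquant_finite p psi wp mpsi.
  split=> //; apply/eqP; rewrite eq_le; apply/andP; split.
    by apply: ereal_sup_ubound; exists (finite_rquant p psi).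
  rewrite cE; apply/ereal_infP => _ [m' /= /hP[i <-] <-].
  rewrite Ipair_finite // lee_fin; apply: le_trans (cy i) _.
  by rewrite le_eqVlt; apply/orP; left; apply/eqP/eq_bigr => j _; have [_ _ ->] := psiP j.
(* The bound [b] passes from half-spaces to all quantizers, then to all randomizations, which puts
   the supremum [c] strictly below itself. *)
- suff : (Imax mu f m <= (b / \sum_i u i)%:E)%E.
    by rewrite cE lee_fin ler_pdivlMr // leNgt bc.
  apply/ereal_supP => _ [q rq <-]; apply: Irq_le => // phi mphi.
  have [a [an0 ua]] := halfspace_improves mu f f_meas f_ge0 f_int1 KL_fin m h u phi u_ge0 mphi.
  by apply: (le_trans ua); apply: Sb; exists a.
Qed.

End Maximin.

Theorem theorem4p3 (R : realType) (d : measure_display) (T : measurableType d)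
  (mu : {sigma_finite_measure set T -> \bar R}) (M : nat) (f : 'I_M -> T -> R)
  (HM : (2 <= M)%N)
  (Hmeas : forall m, measurable_fun setT (f m))
  (Hnonneg : forall m x, 0 <= f m x)
  (Hint1 : forall m, (\int[mu]_x (f m x)%:E = 1)%E)
  (Hkl : forall m m' : 'I_M, m != m' ->
     (0 < KL mu f m m')%E /\ (KL mu f m m' < +oo)%E) :
  forall m : 'I_M,
    (exists q : @rquant R d T, is_maximin mu f m q /\ supported_on_first M.-1 q) /\
    (lin_indep_densities mu f ->
     exists q : @rquant R d T, is_maximin mu f m q /\ supported_on_first M.-1 q /\
       forall j, 0 < rq_w q j -> is_ULQ mu f (rq_phi q j)).
Proof.
move=> m; case: M f HM Hmeas Hnonneg Hint1 Hkl m => [|[|n]] // f _ Hmeas Hnonneg Hint1 Hkl m.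
(* Here [M = n + 2], and [lift m] enumerates the [n + 1] states other than [m]. *)
have [|p [psi [wp qmax qULQ]]] := exists_maximin mu f Hmeas Hnonneg Hint1
    (fun m m' mm' => proj2 (Hkl m m' mm')) m (fun i : 'I_n.+1 => lift m i).
  move=> m'; split=> [|[i <-]]; last by rewrite eq_sym neq_lift.
  by rewrite eq_sym => /unlift_some[i -> _]; exists i.
have supp : supported_on_first n.+1 (finite_rquant p psi).
  by move=> j /=; case: insubP => [//|_] /=; rewrite ltxx.
split; first by exists (finite_rquant p psi).
move=> li; exists (finite_rquant p psi); split=> //; split=> // j /=.
by case: insubP => [i _ _ _|_] /=; [exact: qULQ | rewrite ltxx].
Qed.
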